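(* Let $d\ge1$, $k\in\{1,\dots,d\}$ and $A\in H_{2d}^+(\mathbb{C})$ satisfy Assumptions I' and II'. Let $W_{<1}\in M_d(\mathbb{C})$ be the matrix such that $W_{<1}u_w=wu_w$ for all $w\in\mathcal{S}_{<1}$ and $W_{<1}u_i^{A_{RL}}=0$ for all $i\in\{1,\dots,k\}$. Then $$B_R=A_{LL}+A_{LR}W_{<1}\in H_d^+(\mathbb{C})$$ is right Schur-invariant for $A$. Similarly, let $V\in M_d(\mathbb{C})$ be the (non-invertible) matrix such that $Vu_w=\frac1wu_w$ for all $w\in\mathcal{S}_{>1}$ and $Vu_i^{A_{LR}}=0$ for all $i\in\{1,\dots,k\}$. Then $$B_L=A_{RR}+A_{RL}V$$ is left Schur-invariant for $A$.
   Context: $H_n^+(\mathbb{C})$ is the set of $n\times n$ complex Hermitian positive definite matrices. A matrix $A\in H_{2d}^+(\mathbb{C})$ is written in $d\times d$ blocks $A=\begin{pmatrix} A_{LL} & A_{LR} \\ A_{RL} & A_{RR} \end{pmatrix}$. Define $\Phi(z)=A_{LL}+A_{RR}+A_{LR}z+A_{RL}z^{-1}\in M_d(\mathbb{C})$ for $z\in\mathbb{C}^*$, $\mathcal{S}=\{z\in\mathbb{C}^*:\det\Phi(z)=0\}$, $\mathcal{S}_{<1}=\{w\in\mathcal{S}:|w|<1\}$, $\mathcal{S}_{>1}=\{w\in\mathcal{S}:|w|>1\}$; one has $\mathcal{S}=\mathcal{S}_{<1}\sqcup\mathcal{S}_{>1}$. Assumption I': $\mathrm{rank}(A_{LR})=d-k$;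 bases $(u_i^{A_{LR}})_{i=1}^k$ of $\ker A_{LR}$ and $(u_i^{A_{RL}})_{i=1}^k$ of $\ker A_{RL}$ are fixed. Assumption II': every $w\in\mathcal{S}$ is a simple root of the polynomial $\det(z\Phi(z))$ with $\dim\ker\Phi(w)=1$, and $0$ is a root of $\det(z\Phi(z))=\det(A_{LR}z^2+(A_{LL}+A_{RR})z+A_{RL})$ of multiplicity exactly $k$. For each $w\in\mathcal{S}$ a vector $u_w\neq0$ spanning $\ker\Phi(w)$ is fixed. Under I' and II', $\big((u_w)_{w\in\mathcal{S}_{<1}},(u_i^{A_{RL}})_{i=1}^k\big)$ and $\big((u_w)_{w\in\mathcal{S}_{>1}},(u_i^{A_{LR}})_{i=1}^k\big)$ are bases of $\mathbb{C}^d$, so the matrices in the claim are well defined. $B_L\in M_d(\mathbb{C})$ is left Schur-invariant for $A$ if $B_L\in H_d^+(\mathbb{C})$ and $B_L=A_{RR}-A_{RL}(B_L+A_{LL})^{-1}A_{LR}$. $B_R\in M_d(\mathbb{C})$ is right Schur-invariant for $A$ if $B_R\in H_d^+(\mathbb{C})$ and $B_R=A_{LL}-A_{LR}(A_{RR}+B_R)^{-1}A_{RL}$. *)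

(* Defs.v *)
From HB Require Import structures.
From mathcomp Require Import all_boot all_order all_algebra.
From mathcomp Require Import sesquilinear spectral.
From mathcomp Require Import complex.
From mathcomp Require Import reals.

Set Implicit Arguments.
Unset Strict Implicit.
Unset Printing Implicit Defensive.

Import Order.TTheory GRing.Theory Num.Theory.

Local Open Scope ring_scope.
Local Open Scope sesquilinear_scope.

Section Defs.
Variable C : numClosedFieldType.

(* In C, [0 < z] means that z is real and positive. *)
Definition hermpd (n : nat) (M : 'M[C]_n) : Prop :=
  M \is hermsymmx /\
  forall x : 'cV[C]_n, x != 0 -> 0 < (x ^t* *m M *m x) 0 0.

(* The right kernel {x | M x = 0}; MathComp's [kermx] is the left one. *)
Definition kerc (n : nat) (M : 'M[C]_n) : {vspace 'cV[C]_n} :=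
  lker (linfun (mulmx M)).

Variable d : nat.
Implicit Types (A : 'M[C]_(d + d)) (B W : 'M[C]_d).

Definition blkLL A : 'M[C]_d := ulsubmx A.
Definition blkLR A : 'M[C]_d := ursubmx A.
Definition blkRL A : 'M[C]_d := dlsubmx A.
Definition blkRR A : 'M[C]_d := drsubmx A.

Definition Phi A (z : C) : 'M[C]_d :=
  blkLL A + blkRR A + z *: blkLR A + z^-1 *: blkRL A.

Definition specS A : pred C := fun z => (z != 0) && (\det (Phi A z) == 0).
Definition specS_lt1 A : pred C := fun w => specS A w && (`|w| < 1).
Definition specS_gt1 A : pred C := fun w => specS A w && (1 < `|w|).

(* z Phi(z), as a matrix with polynomial entries (so that z = 0 is allowed). *)
Definition zPhi A : 'M[{poly C}]_d :=
  'X^2 *: map_mx polyC (blkLR A) + 'X *: map_mx polyC (blkLL A + blkRR A)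
  + map_mx polyC (blkRL A).

Definition detzPhi A : {poly C} := \det (zPhi A).

Definition assumptionI (k : nat) A (uLR uRL : k.-tuple 'cV[C]_d) : Prop :=
  [/\ \rank (blkLR A) = (d - k)%N,
      basis_of (kerc (blkLR A)) uLR
    & basis_of (kerc (blkRL A)) uRL].

(* [u] is only meaningful on [specS A]. *)
Definition assumptionII (k : nat) A (u : C -> 'cV[C]_d) : Prop :=
  [/\ forall w, specS A w ->
        mup w (detzPhi A) = 1%N /\ \dim (kerc (Phi A w)) = 1%N,
      mup 0 (detzPhi A) = k
    & forall w, specS A w -> u w != 0 /\ kerc (Phi A w) = <[u w]>%VS].

Definition is_Wlt1 (k : nat) A (u : C -> 'cV[C]_d) (uRL : k.-tuple 'cV[C]_d) W
    : Prop :=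
  (forall w, specS_lt1 A w -> W *m u w = w *: u w) /\
  (forall i : 'I_k, W *m tnth uRL i = 0).

Definition is_Vgt1 (k : nat) A (u : C -> 'cV[C]_d) (uLR : k.-tuple 'cV[C]_d) W
    : Prop :=
  (forall w, specS_gt1 A w -> W *m u w = w^-1 *: u w) /\
  (forall i : 'I_k, W *m tnth uLR i = 0).

(* The inverses below are genuine when A and B are positive definite. *)
Definition left_schur_invariant A B : Prop :=
  hermpd B /\
  B = blkRR A - blkRL A *m invmx (B + blkLL A) *m blkLR A.

Definition right_schur_invariant A B : Prop :=
  hermpd B /\
  B = blkLL A - blkLR A *m invmx (blkRR A + B) *m blkRL A.

End Defs.

(* Main.v *)
Require Import Defs.
From HB Require Import structures.
From mathcomp Require Import all_boot all_order all_algebra.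
From mathcomp Require Import sesquilinear spectral complex reals ring.

(** Put [P = A_LR], [T = A_LL + A_RR]. The chosen vectors with their
    eigenvalues [w], [|w| < 1] ([w = 0] for the kernel vectors), are the
    columns of [U] and the diagonal of [D], with [P U D^2 + T U D + P^* U =
    0]. For [E = (U ; U D)] the matrices [Q = E^* A E >= 0] and [G = U^* (A_LL
    U + P U D)] satisfy the Stein equation [Q = G - D^* G D], which forces [G]
    to be Hermitian with [G >= Q]. Hence [U c = 0] implies [c^* G c = 0], so
    [E c = 0]: the kernel of [U] is [D]-stable, and it vanishes because each
    eigenspace of [D] meets it trivially. When [U] is square, [W = U D U^-1]
    and [B = A_LL + P W] satisfy [U^* B U = G], so [B > 0], and [P W^2 + T W +
    P^* = 0] is the Schur equation. That [U] is square is a root count: [det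
    (z Phi z)] is self-reciprocal and has no root on the unit circle, so [w
    |-> 1 / w^*] exchanges the [2d - 2k] nonzero roots inside and outside the
    disc. The left case is the right one after exchanging [L] and [R] and
    replacing [z] by [1 / z]. *)

Set Implicit Arguments.
Unset Strict Implicit.
Unset Printing Implicit Defensive.

Import Order.TTheory GRing.Theory Num.Theory.
Local Open Scope ring_scope.
Local Open Scope sesquilinear_scope.

(** * The Stein equation with a diagonal matrix of entries inside the unit disc *)

Section Stein.
Variable C : numClosedFieldType.

Lemma trmxC_mul m n p (M : 'M[C]_(m, n)) (N : 'M[C]_(n, p)) :
  (M *m N) ^t* = N ^t* *m M ^t*.
Proof. by rewrite trmx_mul map_mxM. Qed.

Lemma trmxCD m n (M N : 'M[C]_(m, n)) : (M + N) ^t* = M ^t* + N ^t*.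
Proof. by rewrite linearD map_mxD. Qed.

Lemma hermsymmxP n (M : 'M[C]_n) : reflect (M ^t* = M) (M \is hermsymmx).
Proof. by rewrite qualifE /= expr0 scale1r eq_sym; exact: eqP. Qed.

Lemma qform_sum n (M : 'M[C]_n) (x y : 'cV[C]_n) :
  (x ^t* *m M *m y) 0 0 = \sum_j \sum_i (x i 0)^* * M i j * y j 0.
Proof.
rewrite mxE; apply: eq_bigr => j _; rewrite mxE mulr_suml.
by apply: eq_bigr => i _; rewrite !mxE.
Qed.

Lemma herm_qform_real n (M : 'M[C]_n) (x : 'cV[C]_n) :
  M ^t* = M -> (x ^t* *m M *m x) 0 0 \is Num.real.
Proof.
move=> Mh; rewrite CrealE; apply/eqP.
set N := _ *m _; have hN : N ^t* = N by rewrite !trmxC_mul Mh trmxCK mulmxA.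
by rewrite -[in RHS]hN [RHS]mxE [in RHS]mxE.
Qed.

Lemma norm_bound n (l : 'I_n -> C) : (forall i, `|l i| < 1) ->
  exists2 r : C, 0 <= r < 1 & forall i, `|l i| <= r.
Proof.
elim: n l => [|n IHn] l hl; first by exists 0; [rewrite lexx ltr01 | case=> []].
have [r /andP[r0 r1] hr] := IHn _ (fun i => hl (lift ord0 i)).
(* The order on [C] is partial, so the maximum needs comparable arguments. *)
have hcmp : r >=< `|l ord0| by rewrite real_comparable ?ger0_real.
exists (Num.max r `|l ord0|).
  by rewrite comparable_le_max ?comparable_gt_max // r0 r1 hl.
move=> i; rewrite comparable_le_max //.
by case: (unliftP ord0 i) => [j ->|->]; rewrite ?hr ?lexx ?orbT.
Qed.

Hypothesis archiC : Num.archimedean_axiom C.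

(** Bernoulli's inequality for [1 / r = 1 + h] gives at least linear growth of [r^-1 ^+ n], which
    the Archimedean axiom pushes beyond [K / e]. *)
Lemma geometric_small (r K e : C) : 0 <= r < 1 -> 0 <= K -> 0 < e ->
  exists n, K * r ^+ n < e.
Proof.
move=> /andP[r0 r1] K0 e0; have [->|rN0] := eqVneq r 0.
  by exists 1%N; rewrite mulr0.
have {rN0}r0 : 0 < r by rewrite lt_def rN0.
have [h h0 hE] : exists2 h, 0 < h & r^-1 = 1 + h.
  by exists (r^-1 - 1); rewrite ?subr_gt0 ?invf_gt1 // addrC subrK.
have bernoulli n : h * n%:R <= r^-1 ^+ n.
  suff: 1 + h * n%:R <= r^-1 ^+ n by apply: le_trans; rewrite lerDr.
  elim: n => [|n IHn]; first by rewrite mulr0 addr0.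
  apply: (@le_trans _ _ ((1 + h * n%:R) * r^-1)); last first.
    by rewrite exprSr ler_wpM2r // invr_ge0 ltW.
  rewrite hE.
  rewrite mulrDl mul1r mulrDr mulr1 -natr1 mulrDr mulr1.
  rewrite [_ * n%:R + h]addrC -!addrA lerD2l lerD2l lerDl.
  by rewrite !mulr_ge0 // ltW.
have [n hn] := archiC (K / e / h).
exists n; move: hn; rewrite ger0_norm; last first.
  by rewrite !divr_ge0 // ltW.
rewrite ltr_pdivrMr // ltr_pdivrMr // => hn.
rewrite -ltr_pdivlMr ?exprn_gt0 // -exprVn mulrC.
apply: (lt_le_trans hn); rewrite ler_wpM2r ?(ltW e0) //.
by rewrite mulrC.
Qed.

(** Entrywise the equation reads [Q i j = G i j * (1 - (l i)^* l j)]. The factor is nonzero and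
    turns into its conjugate when [i] and [j] are exchanged, so [G] inherits the symmetry of [Q]. *)
Lemma stein_herm n (G Q : 'M[C]_n) (l : 'rV[C]_n) :
  (forall i, `|l 0 i| < 1) -> Q = G - (diag_mx l) ^t* *m G *m diag_mx l ->
  Q ^t* = Q -> G ^t* = G.
Proof.
move=> hl hQ Qh.
have QE i j : Q i j = G i j * (1 - (l 0 i)^* * l 0 j).
  rewrite hQ mulrBr mulr1 [in LHS]mxE [in X in _ + X]mxE; congr (_ - _).
  rewrite mul_mx_diag mxE tr_diag_mx map_diag_mx mul_diag_mx !mxE.
  by rewrite [_^* * G i j]mulrC mulrA.
apply/matrixP=> i j; rewrite !mxE.
have hN : 1 - (l 0 i)^* * l 0 j != 0.
  rewrite subr_eq0; apply: contraTneq (erefl true) => h1.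
  have: `|(l 0 i)^* * l 0 j| < 1.
    by rewrite normrM norm_conjC mulr_ilt1 ?normr_ge0.
  by rewrite -h1 normr1 ltxx.
apply: (mulIf hN); rewrite -QE -Qh !mxE QE rmorphM; congr (_ * _).
by rewrite rmorphB rmorphM rmorph1 /= conjCK mulrC.
Qed.

(* [c^* Q c] is a decrement of [c^* G c] along the orbit [D^n c], and the
   latter tends to [0]. *)
Lemma stein_qform n (G Q : 'M[C]_n) (l : 'rV[C]_n) (c : 'cV[C]_n) :
  (forall i, `|l 0 i| < 1) -> Q = G - (diag_mx l) ^t* *m G *m diag_mx l ->
  Q ^t* = Q -> (forall x : 'cV[C]_n, 0 <= (x ^t* *m Q *m x) 0 0) ->
  (c ^t* *m Q *m c) 0 0 <= (c ^t* *m G *m c) 0 0.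
Proof.
move=> hl hQ Qh Qpos; have Gh := stein_herm hl hQ Qh.
pose q (x : 'cV[C]_n) : C := (x ^t* *m G *m x) 0 0.
have qD x : q x = (x ^t* *m Q *m x) 0 0 + q (diag_mx l *m x).
  rewrite /q hQ mulmxBr mulmxBl [in X in X + _]mxE [in X in _ + X + _]mxE.
  by rewrite trmxC_mul !mulmxA subrK.
suff qpos x : 0 <= q x by rewrite -/(q c) qD lerDl.
pose v k := iter k (fun y => diag_mx l *m y) x.
have q_le k : q (v k) <= q x.
  elim: k => [|k IHk]; first exact: lexx.
  by apply: le_trans IHk; rewrite [leRHS]qD lerDr.
have [r hr lr] := norm_bound hl; have /andP[r0 r1] := hr.
have vE k i : v k i 0 = l 0 i ^+ k * x i 0.
  elim: k => [|k IHk]; first by rewrite mul1r.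
  by rewrite /v iterS -/(v k) mul_diag_mx mxE IHk mulrA exprS.
pose K := \sum_j \sum_i `|x i 0| * `|G i j| * `|x j 0|.
have K0 : 0 <= K by do 2![apply: sumr_ge0 => ? _]; rewrite !mulr_ge0.
have q_bd k : `|q (v k)| <= K * r ^+ k.
  rewrite /q qform_sum /K mulr_suml.
  apply: (le_trans (ler_norm_sum _ _ _)); apply: ler_sum => j _.
  rewrite mulr_suml; apply: (le_trans (ler_norm_sum _ _ _)).
  apply: ler_sum => i _; rewrite !vE !normrM norm_conjC normrM !normrX.
  have -> : `|l 0 i| ^+ k * `|x i 0| * `|G i j| * (`|l 0 j| ^+ k * `|x j 0|)
    = `|x i 0| * `|G i j| * `|x j 0| * (`|l 0 i| ^+ k * `|l 0 j| ^+ k).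
    by ring.
  rewrite ler_wpM2l ?mulr_ge0 //.
  (* One power is bounded by [r ^+ k], the other by [1]. *)
  rewrite -[leRHS]mulr1 ler_pM ?exprn_ge0 ?lerXn2r ?nnegrE //.
  by rewrite exprn_ile1 // ltW.
(* If [q x < 0], then [q (v k) <= q x] keeps the modulus of [q (v k)] at least [- q x], against the
   geometric bound. *)
rewrite real_leNgt ?herm_qform_real ?real0 //; apply/negP => qx0.
have [k] := geometric_small hr K0 (etrans (oppr_gt0 _) qx0).
rewrite real_ltNge ?rpredN ?herm_qform_real //; last first.
  by rewrite realM ?realX ?ger0_real.
move=> /negP; apply; apply: le_trans (q_bd k).
by rewrite ltr0_norm ?lerN2 ?q_le // (le_lt_trans (q_le k)).
Qed.

End Stein.

(** * Positive definite matrices and their blocks *)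

Section Hermpd.
Variable C : numClosedFieldType.

Lemma hermpd_qform_ge0 n (M : 'M[C]_n) (x : 'cV[C]_n) :
  hermpd M -> 0 <= (x ^t* *m M *m x) 0 0.
Proof.
case=> _ Mpos; have [->|/Mpos/ltW//] := eqVneq x 0.
by rewrite mulmx0 mxE.
Qed.

Lemma hermpdD n (M N : 'M[C]_n) : hermpd M -> hermpd N -> hermpd (M + N).
Proof.
move=> hM [/hermsymmxP Nh Npos]; have [/hermsymmxP Mh _] := hM.
split=> [|x x0]; first by apply/hermsymmxP; rewrite trmxCD Mh Nh.
by rewrite mulmxDr mulmxDl mxE ltr_wpDl ?Npos ?hermpd_qform_ge0.
Qed.

Lemma mulmx_inj_unitmx n (M : 'M[C]_n) :
  (forall x : 'cV[C]_n, M *m x = 0 -> x = 0) -> M \in unitmx.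
Proof.
move=> Minj; rewrite -unitmx_tr -row_free_unit -kermx_eq0.
apply/eqP/row_matrixP=> i; rewrite row0; apply: trmx_inj; rewrite trmx0.
apply: Minj; apply: trmx_inj; rewrite trmx_mul trmxK trmx0.
by rewrite -row_mul mulmx_ker row0.
Qed.

Lemma hermpd_unitmx n (M : 'M[C]_n) : hermpd M -> M \in unitmx.
Proof.
case=> _ Mpos; apply: mulmx_inj_unitmx => x Mx0.
apply: contraTeq (erefl true) => /Mpos.
by rewrite -mulmxA Mx0 mulmx0 mxE ltxx.
Qed.

Lemma block_qform d m (LL LR RL RR : 'M[C]_d) (X Y : 'M[C]_(d, m)) :
  (col_mx X Y) ^t* *m block_mx LL LR RL RR *m col_mx X Y =
  X ^t* *m LL *m X + X ^t* *m LR *m Y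
    + Y ^t* *m RL *m X + Y ^t* *m RR *m Y.
Proof.
rewrite tr_col_mx map_row_mx mul_row_block mul_row_col !mulmxDl.
by rewrite -!addrA; congr (_ + _); rewrite addrCA.
Qed.

Lemma hermpd_block d (LL LR RL RR : 'M[C]_d) :
  hermpd (block_mx LL LR RL RR) <->
  [/\ LL ^t* = LL, RR ^t* = RR, LR ^t* = RL
    & forall x y : 'cV[C]_d, (x != 0) || (y != 0) ->
      0 < (x ^t* *m LL *m x + x ^t* *m LR *m y
           + y ^t* *m RL *m x + y ^t* *m RR *m y) 0 0].
Proof.
split=> [[/hermsymmxP]|[hLL hRR hLR hpos]].
  rewrite tr_block_mx map_block_mx => /eq_block_mx [hLL hRL hLR hRR] hpos.
  split=> // x y xy0; rewrite -block_qform; apply: hpos.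
  by rewrite col_mx_eq0 negb_and.
split.
  apply/hermsymmxP; rewrite tr_block_mx map_block_mx hLL hRR hLR.
  by rewrite -hLR trmxCK.
move=> x; rewrite -[x]vsubmxK block_qform col_mx_eq0 negb_and.
exact: hpos.
Qed.

(** The new form at [(x, y)] is the old one at [(y, x)]. This carries the right case over to the
    left one. *)
Lemma hermpd_swap d (LL LR RL RR : 'M[C]_d) :
  hermpd (block_mx LL LR RL RR) -> hermpd (block_mx RR RL LR LL).
Proof.
move=> /hermpd_block[hLL hRR hLR hpos]; apply/hermpd_block; split=> //.
  by rewrite -hLR trmxCK.
move=> x y; rewrite orbC => /hpos; congr (0 < fun_of_matrix _ _ _).
by rewrite [RHS](ACl (4*3*2*1)).
Qed.

End Hermpd.

(** * Injectivity of the eigenvector matrix, and the solvent *)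

Section Pencil.
Variable C : numClosedFieldType.
Hypothesis archiC : Num.archimedean_axiom C.
Variables (d m : nat) (LL LR RL RR : 'M[C]_d).
Variables (U : 'M[C]_(d, m)) (l : 'rV[C]_m).
Hypothesis hA : hermpd (block_mx LL LR RL RR).
Hypothesis hl : forall i, `|l 0 i| < 1.
Let D := diag_mx l.
Hypothesis hU : LR *m U *m D *m D + (LL + RR) *m U *m D + RL *m U = 0.

Let G := U ^t* *m (LL *m U + LR *m U *m D).
Let E := col_mx U (U *m D).
Let Q := E ^t* *m block_mx LL LR RL RR *m E.

(** Multiplying [hU] on the left by [(U D)^*] replaces the terms of [Q] from the lower block row by
    [- D^* G D]. *)
Let Q_stein : Q = G - D ^t* *m G *m D.
Proof.
rewrite /Q /E block_qform /G !mulmxDr mulmxDl opprD !mulmxA addrA.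
have : (U *m D) ^t* *m
    (LR *m U *m D *m D + (LL + RR) *m U *m D + RL *m U) = 0.
  by rewrite hU mulmx0.
rewrite !mulmxDl !mulmxDr !mulmxA -trmxC_mul => h.
rewrite -!addrA; do 2!congr (_ + _); apply/eqP.
by rewrite -opprD -addr_eq0 -h [eqbLHS](AC (2*2) (4*(3*2)*1)).
Qed.

Let Q_herm : Q ^t* = Q.
Proof.
by case: hA => /hermsymmxP Ah _; rewrite /Q !trmxC_mul Ah trmxCK mulmxA.
Qed.

Let Q_qform (c : 'cV[C]_m) : (c ^t* *m Q *m c) 0 0 =
  ((E *m c) ^t* *m block_mx LL LR RL RR *m (E *m c)) 0 0 :> C.
Proof. by rewrite /Q trmxC_mul !mulmxA. Qed.

Let Q_ge0 (c : 'cV[C]_m) : 0 <= (c ^t* *m Q *m c) 0 0.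
Proof. by rewrite Q_qform hermpd_qform_ge0. Qed.

Let ker_stable (c : 'cV[C]_m) : U *m c = 0 -> U *m (D *m c) = 0.
Proof.
move=> Uc0; have := stein_qform archiC c hl Q_stein Q_herm Q_ge0.
rewrite /G mulmxA -trmxC_mul Uc0 trmx0 map_mx0 !mul0mx [X in _ <= X]mxE Q_qform.
have [Ec0 _|Ec0] := eqVneq (E *m c) 0; last first.
  by case: hA => _ /(_ _ Ec0) h /(lt_le_trans h); rewrite ltxx.
move: Ec0; rewrite mul_col_mx mulmxA => /eqP.
by rewrite col_mx_eq0 => /andP[_ /eqP].
Qed.

(* The kernel of [U] is stable under [D], hence under Lagrange interpolation
   polynomials in [D], which project onto the eigenspaces of [D]. *)
Lemma stable_columns_inj :
  (forall (c : 'cV[C]_m) w, (forall i, l 0 i != w -> c i 0 = 0) ->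
     U *m c = 0 -> c = 0) ->
  forall c : 'cV[C]_m, U *m c = 0 -> c = 0.
Proof.
move=> hind c Uc0; apply/colP=> i; rewrite mxE.
(* [p s j] is the value at [l j] of the monic polynomial with roots [s], so the vectors below are
   [p_s(D) c]. *)
pose p s j : C := \prod_(a <- s) (l 0 j - a).
have Up s : U *m \col_j (p s j * c j 0) = 0.
  elim: s => [|a s IHs].
    rewrite -[RHS]Uc0; congr (_ *m _); apply/colP=> j.
    by rewrite mxE /p big_nil mul1r.
  have -> : \col_j (p (a :: s) j * c j 0) =
      D *m (\col_j (p s j * c j 0)) - a *: \col_j (p s j * c j 0).
    apply/colP=> j; rewrite mul_diag_mx !mxE /p big_cons.
    by rewrite -mulrA mulrBl.
  by rewrite mulmxBr ker_stable // -scalemxAr IHs scaler0 subr0.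
(* With every eigenvalue other than [l i] as a root, [p_s(D) c] lies in the eigenspace of [l i],
   while its [i]-th entry is a nonzero multiple of [c i]. *)
pose s := [seq l 0 j | j <- enum 'I_m & l 0 j != l 0 i].
have /colP/(_ i)/eqP : \col_j (p s j * c j 0) = 0.
  apply: (hind _ (l 0 i)); last exact: Up.
  move=> j lji; rewrite mxE /p.
  rewrite (big_rem (l 0 j)) /= ?subrr ?mul0r //.
  by apply/mapP; exists j => //; rewrite mem_filter lji mem_enum.
rewrite !mxE mulf_eq0 => /orP[|/eqP//].
rewrite /p prodf_seq_eq0 => /hasP[a /mapP[j + ->]].
by rewrite mem_filter => /andP[lji _]; rewrite subr_eq0 eq_sym (negPf lji).
Qed.

Section Solvent.
Variables (W : 'M[C]_d) (V : 'M[C]_(m, d)).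
Hypotheses (WU : W *m U = U *m D) (UV : U *m V = 1%:M).
Let B := LL + LR *m W.

Let G_B : G = U ^t* *m B *m U.
Proof.
rewrite /G /B -[in RHS]mulmxA mulmxDl -[LR *m W *m U]mulmxA WU.
by rewrite [LR *m (U *m D)]mulmxA.
Qed.

(** [B = V^* G V], and [G] dominates [Q], whose form at [V x] is that of the block matrix at
    [E V x], a vector with upper block [x]. *)
Lemma solvent_hermpd : hermpd B.
Proof.
have BE : B = V ^t* *m G *m V.
  rewrite G_B 2!mulmxA -trmxC_mul -2!mulmxA UV trmx1 map_mx1.
  by rewrite mul1mx mulmx1.
split=> [|x x0].
  apply/hermsymmxP; rewrite BE 2!trmxC_mul trmxCK.
  by rewrite (stein_herm hl Q_stein Q_herm) mulmxA.
have -> : x ^t* *m B *m x = (V *m x) ^t* *m G *m (V *m x).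
  by rewrite BE trmxC_mul !mulmxA.
apply: lt_le_trans (stein_qform archiC (V *m x) hl Q_stein Q_herm Q_ge0).
rewrite Q_qform; case: hA => _; apply.
by rewrite mul_col_mx col_mx_eq0 mulmxA UV mul1mx (negPf x0).
Qed.

(** By [W U = U D], the left side of [hU] is [((RR + B) W + RL) U]. Cancelling [U] gives
    [W = - (RR + B)^-1 RL], to be put into [B = LL + LR W]. *)
Lemma solvent_schur : B = LL - LR *m invmx (RR + B) *m RL.
Proof.
have RRB : RR + B \in unitmx.
  apply/hermpd_unitmx/hermpdD/solvent_hermpd.
  have /hermpd_block[_ RRh _ hpos] := hA.
  split=> [|x x0]; first exact/hermsymmxP.
  have := hpos 0 x; rewrite x0 orbT => /(_ isT).
  by rewrite trmx0 map_mx0 !mul0mx !add0r mulmx0 add0r.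
suff /eqP : (RR + B) *m W + RL = 0.
  rewrite addr_eq0 => /eqP /(congr1 (mulmx (invmx (RR + B)))).
  by rewrite mulKmx // => WE; rewrite {1}/B WE mulmxN mulmxN mulmxA.
have : ((RR + B) *m W + RL) *m U = 0.
  rewrite -[RHS]hU /B addrA [RR + LL]addrC.
  rewrite [(_ + _) *m W]mulmxDl !mulmxDl -!mulmxA WU.
  rewrite [W *m (U *m D)]mulmxA WU !mulmxA.
  by rewrite [X in X + _ = _]addrC.
by move=> /(congr1 (mulmx^~ V)); rewrite -mulmxA UV mulmx1 mul0mx.
Qed.
End Solvent.

End Pencil.

(** * Symmetry and counting of the spectrum *)

Section Spectrum.
Variable C : numClosedFieldType.

(** The factor ['X] absorbs the excluded point: ['X * (p - q)] vanishes everywhere, and over an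
    algebraically closed field only the zero polynomial does. *)
Lemma poly_eq_neq0 (p q : {poly C}) :
  (forall z, z != 0 -> p.[z] = q.[z]) -> p = q.
Proof.
move=> pq; suff : 'X * (p - q) == 0.
  by rewrite mulf_eq0 polyX_eq0 subr_eq0 => /eqP.
apply/negPn/negP => /closed_nonrootP[z]; rewrite rootE !hornerE.
have [->|z0] := eqVneq z 0; first by rewrite mul0r eqxx.
by rewrite pq // subrr mulr0 eqxx.
Qed.

(** Let [c] be the leading coefficient and [r] the product of the [1 - x^* X] over the roots [x] of
    [p]. The symmetry becomes [X^(deg p) p = c^* X^n r]; as [r(0) = 1], comparing orders at [0]
    gives the count. *)
Lemma self_reciprocal_size (p : {poly C}) n : p != 0 ->
  (forall z, z != 0 -> p.[z] = z ^+ n * (p.[(z^*)^-1])^*) ->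
  ((size p).-1 + mup 0 p)%N = n.
Proof.
move=> p0 hp; have [rs pE] := closed_field_poly_normal p.
have c0 : lead_coef p != 0 by rewrite lead_coef_eq0.
have -> : (size p).-1 = size rs.
  by rewrite {1}pE size_scale // size_prod_XsubC.
pose r := \prod_(x <- rs) (1 - x^* *: 'X).
have r0 : ~~ root r 0.
  rewrite rootE horner_prod prodf_seq_neq0; apply/allP => x _ /=.
  by rewrite !hornerE ?mulr0 ?subr0 oner_neq0.
have E : 'X^(size rs) * p = (lead_coef p)^* *: ('X^n * r).
  apply: poly_eq_neq0 => z z0; rewrite hornerZ !hornerM !hornerXn hp //.
  rewrite {1}pE hornerZ rmorphM /= mulrCA [RHS]mulrCA; congr (_ * _).
  rewrite mulrCA; congr (_ * _); rewrite horner_prod rmorph_prod.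
  rewrite /r horner_prod; elim: (rs) => [|x s IHs] /=.
    by rewrite !big_nil mulr1.
  rewrite !big_cons exprS mulrACA IHs; congr (_ * _).
  rewrite !hornerE rmorphB /= fmorphV /= conjCK mulrBr divff // mulrC.
  by rewrite [x^* * z]mulrC.
have X0 m : 'X^m != 0 :> {poly C} by rewrite monic_neq0 ?monicXn.
have mupX m : mup 0 ('X^m : {poly C}) = m.
  by have := mup_XsubCX m 0 (0 : C); rewrite subr0 eqxx.
have := congr1 (mup 0) E; rewrite -mul_polyC mupM // mupX => ->.
by rewrite mupMr ?rootC ?conjC_eq0 // mupMl // mupX.
Qed.

Variables (d : nat) (A : 'M[C]_(d + d)).

Lemma scale_Phi w : w != 0 ->
  w *: Phi A w = w ^+ 2 *: blkLR A + w *: (blkLL A + blkRR A) + blkRL A.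
Proof. by move=> w0; apply/matrixP=> i j; rewrite !mxE; field. Qed.

(** Inverting [w] exchanges the roles of [L] and [R]: an eigenvector at [w] solves the swapped
    quadratic equation at [1 / w]. *)
Lemma scale_inv_Phi w : w != 0 ->
  w^-1 *: Phi A w =
  w^-1 ^+ 2 *: blkRL A + w^-1 *: (blkRR A + blkLL A) + blkLR A.
Proof. by move=> w0; apply/matrixP=> i j; rewrite !mxE; field. Qed.

Hypothesis hA : hermpd A.

Let hblk : hermpd (block_mx (blkLL A) (blkLR A) (blkRL A) (blkRR A)).
Proof. by rewrite submxK. Qed.

Lemma horner_detzPhi z : z != 0 ->
  (detzPhi A).[z] = z ^+ d * \det (Phi A z).
Proof.
move=> z0; rewrite -detZ -[LHS]/(horner_eval z _) /detzPhi -det_map_mx.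
congr (\det _); apply/matrixP=> i j; rewrite !mxE /= /horner_eval !hornerE.
by field.
Qed.

(** As [A] is Hermitian, reflection in the unit circle acts as the adjoint. It therefore preserves
    the spectrum and makes [detzPhi A] self-reciprocal. *)
Lemma Phi_conj z : Phi A (z^*)^-1 = (Phi A z) ^t*.
Proof.
have /hermpd_block[hLL hRR hLR _] := hblk.
apply/esym; rewrite /Phi !trmxCD !linearZ /= !map_mxZ hLL hRR.
have hRL : (blkRL A) ^t* = blkLR A by rewrite -hLR trmxCK.
rewrite hLR hRL fmorphV invrK /= -!addrA; do 2!congr (_ + _).
by rewrite addrC.
Qed.

(** On the circle [z^* = 1 / z], so [x^* Phi(z) x] is the form of [A] at [(x, z x)], which is
    positive for [x != 0]. *)
Lemma Phi_unit_circle z : `|z| = 1 -> \det (Phi A z) != 0.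
Proof.
move=> z1; rewrite -unitfE -unitmxE.
apply: mulmx_inj_unitmx => x Phix0; apply: contraTeq (erefl true) => x0.
have /hermpd_block[_ _ _ /(_ x (z *: x))] := hblk.
rewrite x0 => /(_ isT).
have zz : z^* * z = 1 by rewrite mulrC -normCK z1 expr1n.
have z0 : z != 0 by rewrite -normr_gt0 z1 ltr01.
have zV : z^* = z^-1 by apply: (mulIf z0); rewrite zz mulVf.
have -> : x ^t* *m blkLL A *m x + x ^t* *m blkLR A *m (z *: x)
     + (z *: x) ^t* *m blkRL A *m x + (z *: x) ^t* *m blkRR A *m (z *: x)
   = x ^t* *m (Phi A z *m x).
  have -> : (z *: x) ^t* = z^* *: x ^t* by rewrite linearZ map_mxZ.
  rewrite -!scalemxAl -!scalemxAr !scalerA zz scale1r zV.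
  rewrite /Phi !mulmxDl !mulmxDr -!scalemxAl -!scalemxAr !mulmxA.
  by rewrite [RHS](ACl (1*3*4*2)).
by rewrite Phix0 mulmx0 mxE ltxx.
Qed.

Lemma detzPhi_neq0 : detzPhi A != 0.
Proof.
apply: contraTneq (Phi_unit_circle (normr1 C)) => D0.
have := horner_detzPhi (oner_neq0 C).
by rewrite D0 horner0 expr1n mul1r => <-; rewrite eqxx.
Qed.

Lemma specSE w : specS A w = (w != 0) && root (detzPhi A) w.
Proof.
rewrite /specS; have [//|w0] := eqVneq w 0.
by rewrite rootE horner_detzPhi // mulf_eq0 expf_eq0 (negPf w0) andbF.
Qed.

Lemma specS_inv_conj w : specS A (w^*)^-1 = specS A w.
Proof.
rewrite /specS invr_eq0 conjC_eq0 Phi_conj det_map_mx det_tr.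
by rewrite conjC_eq0.
Qed.

Lemma size_detzPhi : ((size (detzPhi A)).-1 + mup 0 (detzPhi A))%N = (d + d)%N.
Proof.
apply: self_reciprocal_size detzPhi_neq0 _ => z z0.
rewrite !horner_detzPhi ?invr_eq0 ?conjC_eq0 //.
rewrite Phi_conj det_map_mx det_tr rmorphM /= conjCK rmorphXn /=.
by rewrite fmorphV /= conjCK exprVn exprD -mulrA mulVKf ?expf_neq0.
Qed.

Lemma specS_enum k : (forall w, specS A w -> mup w (detzPhi A) = 1%N) ->
  mup 0 (detzPhi A) = k ->
  exists s t : seq C,
    [/\ uniq s, s =i specS_lt1 A & (size s + k)%N = d] /\
    [/\ uniq t, t =i specS_gt1 A & (size t + k)%N = d].
Proof.
move=> hsimple hk; have [rs DE] := closed_field_poly_normal (detzPhi A).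
have c0 : lead_coef (detzPhi A) != 0 by rewrite lead_coef_eq0 detzPhi_neq0.
have mupE x : mup x (detzPhi A) = count_mem x rs.
  by rewrite DE -mul_polyC mupMr ?rootC // mu_prod_XsubC.
pose r := [seq x <- rs | x != 0].
(* The degree is [2d - k] by [size_detzPhi]; dropping the [k] zero roots leaves [2d - 2k]. *)
have size_r : (size r + k + k)%N = (d + d)%N.
  rewrite -size_detzPhi hk; congr (_ + _)%N.
  rewrite {1}DE size_scale // size_prod_XsubC /= -hk mupE.
  by rewrite size_filter addnC -[RHS](count_predC (pred1 0)).
have r_specS : r =i specS A.
  move=> w; rewrite mem_filter [RHS]specSE; congr (_ && _).
  by rewrite DE rootZ // root_prod_XsubC.
(* [r] lists the nonzero roots with multiplicity, so simplicity excludes repetitions. *)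
have r_uniq : uniq r.
  apply: count_mem_uniq => x.
  case: (boolP (x \in r)) => [|/count_memPn //] xr.
  rewrite /r count_filter; have := xr; rewrite r_specS => xS.
  rewrite -[RHS]/1%N -(hsimple _ xS) mupE; apply: eq_count => y /=.
  have [->|//] := eqVneq y x; by move: xr; rewrite mem_filter => /andP[].
pose s := [seq x <- r | `|x| < 1]; pose t := [seq x <- r | 1 < `|x|].
have sE : s =i specS_lt1 A by move=> x; rewrite mem_filter andbC r_specS.
have tE : t =i specS_gt1 A by move=> x; rewrite mem_filter andbC r_specS.
have [us ut] : uniq s /\ uniq t by split; rewrite filter_uniq.
have size_st : (size s + size t)%N = size r.
  rewrite -(count_predC (fun x => `|x| < 1) r) !size_filter.
  congr (_ + _)%N; apply: eq_in_count => x /=.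
  rewrite r_specS => /andP[_ Dx].
  rewrite -real_leNgt ?realE ?ler01 ?normr_ge0 //.
  rewrite le_eqVlt; case: eqVneq => // /esym/Phi_unit_circle.
  by rewrite Dx.
(* Reflection in the unit circle is injective and carries each of [s], [t] into the other, so their
   sizes agree. *)
have inv_inj : injective (fun w : C => (w^*)^-1).
  by move=> x y /invr_inj/(inv_inj conjCK).
have size_le (a b : seq C) : uniq a ->
    {in a, forall w, (w^*)^-1 \in b} -> (size a <= size b)%N.
  move=> ua ab; rewrite -(size_map (fun w : C => (w^*)^-1)) uniq_leq_size //.
    by rewrite map_inj_uniq.
  by move=> _ /mapP[w /ab wb ->].
have eq_st : size s = size t.
  apply/eqP; rewrite eqn_leq !size_le // => w.
    rewrite sE tE => /andP[wS w1]; apply/andP; split.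
      by rewrite specS_inv_conj.
    by rewrite normfV norm_conjC invf_lt1 // (lt_trans ltr01).
  rewrite sE tE => /andP[wS w1]; apply/andP; split.
    by rewrite specS_inv_conj.
  by rewrite normfV norm_conjC invf_gt1 // normr_gt0; case/andP: wS.
have size_s : (size s + k)%N = d.
  apply: double_inj; rewrite -!addnn -size_r -size_st -eq_st.
  by rewrite addnACA addnA.
by exists s, t; split; split=> //; rewrite -eq_st.
Qed.

End Spectrum.

(** * The solvent determined by a family of eigenvectors *)

Section Eigenbasis.
Variable C : numClosedFieldType.
Hypothesis archiC : Num.archimedean_axiom C.

Definition colsmx d m (v : 'I_m -> 'cV[C]_d) : 'M[C]_(d, m) :=
  \matrix_(i, j) v j i 0.

Lemma mul_colsmx d d' m (M : 'M[C]_(d', d)) (v : 'I_m -> 'cV[C]_d) :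
  M *m colsmx v = colsmx (fun j => M *m v j).
Proof.
by apply/matrixP=> i j; rewrite !mxE; apply: eq_bigr => a _; rewrite mxE.
Qed.

Lemma colsmx_diag d m (v : 'I_m -> 'cV[C]_d) (l : 'rV[C]_m) :
  colsmx v *m diag_mx l = colsmx (fun j => l 0 j *: v j).
Proof. by apply/matrixP=> i j; rewrite mul_mx_diag !mxE mulrC. Qed.

Lemma colsmxP d m (v w : 'I_m -> 'cV[C]_d) :
  colsmx v = colsmx w <-> forall j, v j = w j.
Proof.
split=> [/matrixP vw j|vw].
  by apply/colP=> i; have := vw i j; rewrite !mxE.
by apply/matrixP=> i j; rewrite !mxE vw.
Qed.

Lemma colsmx_sum d m (v : 'I_m -> 'cV[C]_d) (c : 'cV[C]_m) :
  colsmx v *m c = \sum_j c j 0 *: v j.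
Proof.
apply/colP=> i; rewrite mxE summxE; apply: eq_bigr => j _.
by rewrite !mxE mulrC.
Qed.

(** The blocks are arbitrary so that both [A] and its swapped form can be inserted. The count
    [size s + k = d] makes the matrix [U] of eigenvectors square. *)
Lemma solvent_of_eigenvectors d k (LL LR RL RR : 'M[C]_d) (s : seq C)
    (u : C -> 'cV[C]_d) (v : k.-tuple 'cV[C]_d) :
  hermpd (block_mx LL LR RL RR) ->
  uniq s -> (size s + k)%N = d ->
  (forall w, w \in s -> [/\ w != 0, `|w| < 1, u w != 0
     & (w ^+ 2 *: LR + w *: (LL + RR) + RL) *m u w = 0]) ->
  free v -> (forall i, RL *m tnth v i = 0) ->
  let solvent W := (forall w, w \in s -> W *m u w = w *: u w) /\
                   (forall i, W *m tnth v i = 0) in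
  (exists! W, solvent W) /\
  (forall W, solvent W -> hermpd (LL + LR *m W) /\
     LL + LR *m W = LL - LR *m invmx (RR + (LL + LR *m W)) *m RL).
Proof.
move=> hA us sd hs vfree hv; subst d => solvent.
pose l1 : 'rV[C]_(size s) := \row_j s`_j.
pose l : 'rV[C]_(size s + k) := row_mx l1 0.
pose U1 := colsmx (fun j : 'I_(size s) => u s`_j).
pose U2 := colsmx (tnth v).
pose U : 'M[C]_(size s + k) := row_mx U1 U2.
have s_in (j : 'I_(size s)) : s`_j \in s by rewrite mem_nth.
have hl j : `|l 0 j| < 1.
  rewrite -(splitK j); case: (split j) => a /=; rewrite ?row_mxEl ?row_mxEr mxE.
    by case: (hs _ (s_in a)).
  by rewrite normr0 ltr01.
have row_diag n (X : 'M[C]_(n, size s)) (Y : 'M[C]_(n, k)) :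
    row_mx X Y *m diag_mx l = row_mx (X *m diag_mx l1) 0.
  rewrite diag_mx_row mul_row_block !mulmx0 add0r addr0.
  by rewrite [diag_mx 0]linear0 mulmx0.
have U2_0 (M : 'M[C]_(size s + k)) :
    M *m U2 = 0 <-> forall i, M *m tnth v i = 0.
  have -> : 0 = colsmx (fun _ : 'I_k => 0 : 'cV[C]_(size s + k)).
    by apply/matrixP=> i j; rewrite !mxE.
  by rewrite mul_colsmx colsmxP.
have hU : LR *m U *m diag_mx l *m diag_mx l + (LL + RR) *m U *m diag_mx l
    + RL *m U = 0.
  rewrite /U !mul_mx_row !row_diag !add_row_mx (U2_0 RL).2 // !addr0.
  rewrite -[RHS]row_mx0; congr row_mx.
  rewrite /U1 !mul_colsmx !colsmx_diag.
  apply/matrixP=> i j; have [_ _ _ /colP/(_ i)] := hs _ (s_in j).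
  rewrite !mulmxDl -!scalemxAl [RHS]mxE => E; rewrite [RHS]mxE -[RHS]E !mxE.
  by congr (_ + _ + _); rewrite ?expr2 ?mulrA.
(* The conditions on [W] amount to [W U = U D], so unique existence reduces to the invertibility of
   [U]. *)
have solventP W : solvent W <-> W *m U = U *m diag_mx l.
  rewrite row_diag mul_mx_row; split=> [[Ws Wv]|/eq_row_mx[WU1 /U2_0 Wv]].
    rewrite (U2_0 W).2 //; congr row_mx.
    rewrite /U1 mul_colsmx colsmx_diag; apply/colsmxP=> j.
    by rewrite mxE Ws.
  split=> // w ws; move: WU1.
  rewrite /U1 mul_colsmx colsmx_diag => /colsmxP.
  have wi : (index w s < size s)%N by rewrite index_mem.
  by move=> /(_ (Ordinal wi)); rewrite mxE /= nth_index.
(* An eigenvector of [D] in the kernel of [U] vanishes: for [w = 0] only the free family [v]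
   contributes, as [0] is not in [s]; for [w != 0] at most one nonzero column does, as [s] has no
   repetition. *)
have hind (c : 'cV[C]_(size s + k)) w :
    (forall i, l 0 i != w -> c i 0 = 0) -> U *m c = 0 -> c = 0.
  rewrite -[c]vsubmxK; move: (usubmx c) (dsubmx c) => c1 c2 {c} hc.
  have c1_0 (j : 'I_(size s)) : s`_j != w -> c1 j 0 = 0.
    by have := hc (lshift k j); rewrite row_mxEl mxE col_mxEu.
  have c2_0 (j : 'I_k) : 0 != w -> c2 j 0 = 0.
    by have := hc (rshift (size s) j); rewrite row_mxEr mxE col_mxEd.
  rewrite mul_row_col; have [w0|wN0] := eqVneq w 0.
    have -> : c1 = 0.
      apply/colP=> j; rewrite mxE c1_0 // w0.
      by case: (hs _ (s_in j)).
    rewrite mulmx0 add0r colsmx_sum => sum0.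
    suff -> : c2 = 0 by rewrite col_mx0.
    apply/colP=> j; rewrite mxE; move/freeP: vfree => vfree.
    apply: (vfree (fun j => c2 j 0)); rewrite -[RHS]sum0.
    by apply: eq_bigr => a _; rewrite (tnth_nth 0).
  have -> : c2 = 0 by apply/colP=> j; rewrite mxE c2_0 // eq_sym.
  rewrite mulmx0 addr0 colsmx_sum => sum0.
  suff -> : c1 = 0 by rewrite col_mx0.
  apply/colP=> j; rewrite mxE; have [sjw|/c1_0//] := eqVneq s`_j w.
  move: sum0; rewrite (bigD1 j) //= big1 ?addr0 => [/eqP|a aj].
    rewrite scaler_eq0 => /orP[/eqP//|]; case: (hs _ (s_in j)) => _ _ uN0 _.
    by rewrite (negPf uN0).
  by rewrite c1_0 ?scale0r // -sjw nth_uniq.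
have Uunit : U \in unitmx.
  exact/mulmx_inj_unitmx/(stable_columns_inj archiC hA hl hU hind).
split.
  exists (U *m diag_mx l *m invmx U); split.
    by apply/solventP; rewrite mulmxKV.
  by move=> W /solventP <-; rewrite mulmxK.
move=> W /solventP WU; have UV := mulmxV Uunit.
split; first exact: (solvent_hermpd archiC hA hl hU WU UV).
exact: (solvent_schur archiC hA hl hU WU UV).
Qed.

End Eigenbasis.

(** * The theorem over [R[i]] *)

(** The modulus is a real number, so its bound comes from [R]. *)
Lemma complex_archimedean (R : realType) : Num.archimedean_axiom R[i].
Proof.
move=> x; rewrite normc_def; set r := Num.sqrt _.
exists (Num.bound r); rewrite -(rmorph_nat (real_complex R)) ltcR.
by rewrite archi_boundP // sqrtr_ge0.
Qed.

Lemma kercP (C : numClosedFieldType) n (M : 'M[C]_n) x :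
  reflect (M *m x = 0) (x \in kerc M).
Proof. by rewrite memv_ker lfunE; exact: eqP. Qed.

Theorem theorem7p2 (R : realType) (d k : nat) (A : 'M[R[i]]_(d + d))
    (uLR uRL : k.-tuple 'cV[R[i]]_d) (u : R[i] -> 'cV[R[i]]_d)
    (hd : (1 <= d)%N) (hk : (1 <= k <= d)%N)
    (hA : hermpd A)
    (hI : assumptionI A uLR uRL)
    (hII : assumptionII k A u) :
  ((exists! W : 'M[R[i]]_d, is_Wlt1 A u uRL W) /\
   (forall W : 'M[R[i]]_d, is_Wlt1 A u uRL W ->
      hermpd (blkLL A + blkLR A *m W) /\
      right_schur_invariant A (blkLL A + blkLR A *m W))) /\
  ((exists! V : 'M[R[i]]_d, is_Vgt1 A u uLR V) /\
   (forall V : 'M[R[i]]_d, is_Vgt1 A u uLR V ->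
      V \notin unitmx /\
      left_schur_invariant A (blkRR A + blkRL A *m V))).
Proof.
have archiC := @complex_archimedean R.
have hblk : hermpd (block_mx (blkLL A) (blkLR A) (blkRL A) (blkRR A)).
  by rewrite submxK.
have [_ bLR bRL] := hI; have [hsimple h0 hu] := hII.
have [s [t [[us sE size_s] [ut tE size_t]]]] :=
  specS_enum hA (fun w wS => (hsimple w wS).1) h0.
have Phiu w : specS A w -> Phi A w *m u w = 0.
  by move=> /hu[_ kE]; apply/kercP; rewrite kE memv_line.
have ker_tnth M (b : k.-tuple 'cV[R[i]]_d) i :
    basis_of (kerc M) b -> M *m tnth b i = 0.
  by move=> /basis_mem bM; apply/kercP/bM/mem_tnth.
split.
  have hs w : w \in s -> [/\ w != 0, `|w| < 1, u w != 0
      & (w ^+ 2 *: blkLR A + w *: (blkLL A + blkRR A) + blkRL A) *m u w = 0].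
    rewrite sE => /andP[wS w1]; have [w0 _] := andP wS.
    split=> //; first by case: (hu _ wS).
    by rewrite -scale_Phi // -scalemxAl Phiu // scaler0.
  have [[W [Wsol Wuniq]] solP] := solvent_of_eigenvectors archiC hblk us size_s
    hs (basis_free bRL) (fun i => ker_tnth _ _ i bRL).
  have solE W' : is_Wlt1 A u uRL W' <->
      (forall w, w \in s -> W' *m u w = w *: u w) /\
      (forall i, W' *m tnth uRL i = 0).
    split=> -[h1 h2]; split=> // w; first by rewrite sE; exact: h1.
    by move=> wS; apply: h1; rewrite sE.
  split; first by exists W; split=> [|W' /solE/Wuniq]; first exact/solE.
  by move=> W' /solE/solP[hB BE].
(* Left case: the eigenvalues are the inverses of those outside the disc, and the eigenvector
   attached to [w] is [u w^-1]. *)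
have hs w : w \in map GRing.inv t -> [/\ w != 0, `|w| < 1, u w^-1 != 0
    & (w ^+ 2 *: blkRL A + w *: (blkRR A + blkLL A) + blkLR A) *m u w^-1 = 0].
  move=> /mapP[z]; rewrite tE => /andP[zS z1] ->; have [z0 _] := andP zS.
  rewrite invrK; split; first by rewrite invr_eq0.
  - by rewrite normfV invf_lt1 // (lt_trans ltr01).
  - by case: (hu _ zS).
  by rewrite -scale_inv_Phi // -scalemxAl Phiu // scaler0.
have ut' : uniq (map GRing.inv t) by rewrite map_inj_uniq //; exact: invr_inj.
have size_t' : (size (map GRing.inv t) + k)%N = d by rewrite size_map.
have [[V [Vsol Vuniq]] solP] := solvent_of_eigenvectors archiC
  (hermpd_swap hblk) ut' size_t' hs (basis_free bLR)
  (fun i => ker_tnth _ _ i bLR).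
have solE V' : is_Vgt1 A u uLR V' <->
    (forall w, w \in map GRing.inv t -> V' *m u w^-1 = w *: u w^-1) /\
    (forall i, V' *m tnth uLR i = 0).
  split=> -[h1 h2]; split=> // w.
    by move=> /mapP[z]; rewrite tE => zS ->; rewrite invrK; exact: h1.
  move=> wS; have := h1 w^-1; rewrite invrK; apply.
  by rewrite map_f // tE.
split; first by exists V; split=> [|V' /solE/Vuniq]; first exact/solE.
move=> V' VP; have [hB BE] := solP V' ((solE V').1 VP); split.
  (* Since [k >= 1], [V'] kills a nonzero vector of the basis of the kernel of [A_LR]. *)
  have [k0 _] := andP hk; have [_ /(_ (Ordinal k0)) Vv] := VP.
  apply: contraL (free_not0 (basis_free bLR) (mem_tnth (Ordinal k0) _)).
  by move=> /mulKmx VK; rewrite -[tnth _ _]VK Vv mulmx0 eqxx.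
split; first exact: hB.
by rewrite [X in invmx X]addrC; exact: BE.
Qed.
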